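(* For all positive integers $n$, \[ \log_2 \log_2 c_0(n) < n^5 \quad \text{and} \quad \log_2 \log_2 \log_2 f_0(n) < n^3 . \]
   Context: For a matroid $M$ that is linearly representable over some field, let $c(M)$ be the least positive characteristic of a field over which $M$ is representable, and let $f(M)$ be the order of the smallest (finite) field over which $M$ is representable; both exist by theorems of Rado. For a positive integer $n$, let $c_0(n)$ be the maximum of $c(M)$, and $f_0(n)$ the maximum of $f(M)$, taken over all $n$-element matroids $M$ that are representable over a field of characteristic $0$. Convention: $\log_2 0 = -\infty$, so the second inequality means $f_0(n) < 2^{2^{2^{n^3}}}$. *)

(* Defs.v *)
From HB Require Import structures.
From mathcomp Require Import all_boot all_order all_algebra.
From mathcomp Require Import all_classical all_reals all_analysis.

Set Implicit Arguments.
Unset Strict Implicit.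
Unset Printing Implicit Defensive.

Import Order.TTheory GRing.Theory Num.Theory.

Local Open Scope classical_set_scope.
Local Open Scope ring_scope.

Record matroid (E : finType) := Matroid {
  indep :> {set {set E}};
  indep0 : finset.set0 \in indep;
  indepS : forall I J : {set E}, J \in indep -> I \subset J -> I \in indep;
  indep_aug : forall I J : {set E}, I \in indep -> J \in indep ->
    (#|I| < #|J|)%N -> exists2 x, x \in J :\: I & (x |: I)%SET \in indep }.

(* [free] is applied to the family (v e), e in I, as a sequence: parallel
   elements, mapped to repeated vectors, are therefore dependent. *)
Definition representable (E : finType) (M : matroid E) (F : fieldType) : Prop :=
  exists (r : nat) (v : E -> 'cV[F]_r),
    forall I : {set E}, (I \in indep M) = free [seq v e | e in I].

Definition representable0 (E : finType) (M : matroid E) : Prop :=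
  exists2 F : fieldType, [pchar F] =i pred0 & representable M F.

Definition repr_chars (E : finType) (M : matroid E) : set nat :=
  [set p | exists2 F : fieldType, p \in [pchar F] & representable M F].

Definition repr_orders (E : finType) (M : matroid E) : set nat :=
  [set q | exists2 F : finFieldType, #|F| = q & representable M F].

Section ExtremalValues.
Variable R : realType.
Local Open Scope ereal_scope.

(* The least element of a set of natural numbers, and +oo for the empty set;
   see [leastP] and [least_pinfty]. *)
Definition least (A : set nat) : \bar R := ereal_inf [set k%:R%:E | k in A].

Definition c (E : finType) (M : matroid E) : \bar R := least (repr_chars M).

Definition f (E : finType) (M : matroid E) : \bar R := least (repr_orders M).

(* The supremum of g over the n-element matroids representable in
   characteristic 0; when finite it is a maximum, see [c0P] and [f0P]. *)
Definition sup_repr0 (g : forall E : finType, matroid E -> \bar R) (n : nat) :=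
  ereal_sup [set x | exists (E : finType) (M : matroid E),
    [/\ #|E| = n, representable0 M & x = g E M]].

Definition c0 (n : nat) : \bar R := sup_repr0 c n.

Definition f0 (n : nat) : \bar R := sup_repr0 f n.

(* [lne x = -oo] for every [x <= 0], so in particular [log2e 0 = -oo]. *)
Definition log2e (x : \bar R) : \bar R := lne x * ((ln 2)^-1)%:E.

Lemma least_pinfty (A : set nat) : least A = +oo <-> A = set0.
Proof.
split=> [A_oo|->]; last by rewrite /least image_set0 ereal_inf0.
rewrite -subset0 => k Ak.
have : least A <= k%:R%:E by apply: ereal_inf_lbound; exists k.
by rewrite A_oo.
Qed.

Lemma leastP (A : set nat) (m : nat) :
  least A = m%:R%:E <-> A m /\ (forall k, A k -> (m <= k)%N).
Proof.
have le_least k : A k -> least A <= k%:R%:E.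
  by move=> Ak; apply: ereal_inf_lbound; exists k.
have min_least j : A j -> (forall k, A k -> (j <= k)%N) -> least A = j%:R%:E.
  move=> Aj minj; apply/eqP; rewrite eq_le le_least//=.
  by apply: le_ereal_inf_tmp => _ [k Ak <-]; rewrite lee_fin ler_nat minj.
split=> [Am|[]]; last exact: min_least.
have exA : exists k, `[< A k >].
  have [A0|/set0P[k Ak]] := eqVneq A set0; last by exists k; apply/asboolP.
  by move: Am; rewrite ((least_pinfty A).2 A0).
case: (ex_minnP exA) => j /asboolP Aj minj.
have minj' k : A k -> (j <= k)%N by move=> Ak; apply/minj/asboolP.
move: Am; rewrite (min_least _ Aj minj') => -[] /eqP.
by rewrite eqr_nat => /eqP <-.
Qed.

Lemma sup_repr0P (S : forall E : finType, matroid E -> set nat) (n m : nat) :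
  sup_repr0 (fun E M => least (S E M)) n = m%:R%:E <->
  (exists (E : finType) (M : matroid E),
     [/\ #|E| = n, representable0 M & least (S E M) = m%:R%:E]) /\
  (forall (E : finType) (M : matroid E), #|E| = n -> representable0 M ->
     least (S E M) <= m%:R%:E).
Proof.
rewrite /sup_repr0; set X := [set x | _].
have least_nat E M : least (S E M) < +oo ->
    exists k : nat, least (S E M) = k%:R%:E.
  have [->|/set0P[k Sk]] := eqVneq (S E M) set0.
    by rewrite ((least_pinfty _).2 erefl) ltxx.
  have exS : exists k, `[< S E M k >] by exists k; apply/asboolP.
  move=> _; case: (ex_minnP exS) => j /asboolP Sj minj.
  by exists j; apply/leastP; split=> // i Si; apply/minj/asboolP.
split=> [supX|[[E [M [En M0 Mm]]] ubm]]; last first.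
  apply/eqP; rewrite eq_le; apply/andP; split.
    by apply: ge_ereal_sup => _ [E' [M' [? ? ->]]]; exact: ubm.
  by apply: ereal_sup_ubound; exists E, M; split.
have ubm E (M : matroid E) : #|E| = n -> representable0 M ->
    least (S E M) <= m%:R%:E.
  by move=> En M0; rewrite -supX; apply: ereal_sup_ubound; exists E, M; split.
split=> //; apply: contrapT => noM.
have : ereal_sup X <= (m%:R - 1)%:E.
  apply: ge_ereal_sup => _ [E [M [En M0 ->]]].
  have [k kE] := least_nat _ M (le_lt_trans (ubm _ _ En M0) (ltry _)).
  have := ubm _ _ En M0; rewrite kE !lee_fin ler_nat leq_eqVlt => /orP[/eqP km|].
    by case: noM; exists E, M; split; rewrite // kE km.
  by rewrite lerBrDr natr1 ler_nat.
by rewrite supX lee_fin lerBrDr gerDl ler10.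
Qed.

Lemma c0P (n m : nat) : c0 n = m%:R%:E <->
  (exists (E : finType) (M : matroid E),
     [/\ #|E| = n, representable0 M & c M = m%:R%:E]) /\
  (forall (E : finType) (M : matroid E), #|E| = n -> representable0 M ->
     c M <= m%:R%:E).
Proof. exact: (sup_repr0P repr_chars). Qed.

Lemma f0P (n m : nat) : f0 n = m%:R%:E <->
  (exists (E : finType) (M : matroid E),
     [/\ #|E| = n, representable0 M & f M = m%:R%:E]) /\
  (forall (E : finType) (M : matroid E), #|E| = n -> representable0 M ->
     f M <= m%:R%:E).
Proof. exact: (sup_repr0P repr_orders). Qed.

End ExtremalValues.

(* Main.v *)
From HB Require Import structures.
Require Import Defs.
From mathcomp Require Import all_boot all_order all_fingroup all_algebra
  all_field.
From mathcomp Require Import all_classical all_reals all_analysis.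
From mathcomp Require Import zify.

Set Implicit Arguments.
Unset Strict Implicit.
Unset Printing Implicit Defensive.

Import Order.TTheory GRing.Theory Num.Theory.
Local Open Scope ring_scope.

(** Why the bounds hold. A representation of an [n]-element matroid of rank [k]
can be normalized so that some basis carries an identity matrix; the other [N =
k (n - k) <= n ^ 2 / 4] entries are a point [x] of affine space. That the
matrix represents the matroid says that certain minors, integer polynomials in
[x], vanish, and that one product [g] of minors does not. The task is to move
such a point from characteristic 0 to a finite field, with explicit bounds.

The coordinates are handled one at a time ([elimination]). Call a polynomial
[d]-bounded if each partial degree is at most [d] and its coefficients have
total size at most [2 ^ d]. Suppose that all [d]-bounded relations of [(x_0,
.., x_n)] are to be preserved, together with [g <> 0]. As polynomials in the
last variable, the relations vanish at [x_n] and [g ^ d] does not, hence [g ^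
d] is outside the ideal that they generate. Part of this is linear algebra over
the field generated by [x_0, .., x_(n-1)]: the coefficient vector of [g ^ d]
lies outside the span of those of the shifted relations [X ^ j f]. It is
witnessed by one nonzero minor [g'], while the maximality of the rank is
witnessed by vanishing minors. So it persists at every point [y] over a finite
field [K] that satisfies the [d ^ 5]-bounded relations of [(x_0, .., x_(n-1))]
and [g' <> 0]. There the relations, specialized at [y], have an irreducible
common factor that does not divide [g]: otherwise [g ^ d] would be a multiple
of their gcd, and Bezout coefficients of small degree would put it into the
span. Adjoining a root of this factor, at the cost of an extension of degree at
most [d], gives the missing coordinate.

Because only the relations true at the given point are followed, a step takes
[d] to [d ^ 5], with no growth from the number of relations. After [N] steps
([specialization]) the relations are between integers, hence trivial in
characteristic 0, and the only remaining condition on the finite prime field is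
that it is larger than [D = d ^ (5 ^ N)] and that one nonzero integer of size
at most [2 ^ D] does not vanish in it.

Chebyshev's argument on the central binomial coefficient yields a prime, of
size polynomial in [D], that does not divide a given integer of that size
([exists_prime_ndvdn]). Hence the characteristic is doubly exponential, and the
field, of degree at most [D] over the prime field, is triply exponential
([representable_finite]). With [d = 2 ^ (3 n)] and [4 N <= n ^ 2] the bounds
follow for [n >= 2]; the matroids on one element are representable over every
field. *)

(** * Integer polynomials in several variables *)

(** Iterating univariate polynomials puts the last variable outermost: an
element of [ipoly n.+1] is the polynomial in the variable to be eliminated,
with coefficients in the remaining ones. *)
Fixpoint ipoly (n : nat) : comNzRingType :=
  if n is m.+1 then {poly (ipoly m)} else int.

Fixpoint var (n i : nat) : ipoly n :=
  match n return ipoly n with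
  | 0 => 0
  | m.+1 => if i == m then ('X : {poly ipoly m}) else (var m i)%:P
  end.

Fixpoint ev (F : fieldType) (x : nat -> F) (n : nat) : {rmorphism ipoly n -> F}
  :=
  match n return {rmorphism ipoly n -> F} with
  | 0 => (intmul 1 : {rmorphism int -> F})
  | m.+1 => (horner_eval (x m) \o map_poly (ev x m) : {rmorphism {poly ipoly m}
    -> F})
  end.

(** The sum of the absolute values of all integer coefficients:
submultiplicative, so that it controls determinants. *)
Fixpoint l1norm (n : nat) : ipoly n -> nat :=
  match n return ipoly n -> nat with
  | 0 => fun z : int => `|z|%N
  | m.+1 => fun p : {poly ipoly m} => (\sum_(i < size p) l1norm (p`_i)%R)%N
  end.

(** Partial degrees: the degree in the last variable determines the size of the
linear systems of an elimination step, the other ones the growth of their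
minors. *)
Fixpoint degle (n d : nat) : ipoly n -> Prop :=
  match n return ipoly n -> Prop with
  | 0 => fun _ => True
  | m.+1 => fun p : {poly ipoly m} =>
     (size p <= d.+1)%N /\ forall i, degle d p`_i
  end.

Lemma evS (F : fieldType) (x : nat -> F) n (p : {poly ipoly n}) :
  ev x n.+1 p = (map_poly (ev x n) p).[x n].
Proof. by []. Qed.

Lemma ev_var (F : fieldType) (x : nat -> F) n i : (i < n)%N ->
  ev x n (var n i) = x i.
Proof.
elim: n => // n IHn lt_i_n; rewrite evS /=.
have [->|neq_in] := eqVneq i n; first by rewrite map_polyX hornerX.
by rewrite map_polyC hornerC; apply: IHn; rewrite ltn_neqAle neq_in -ltnS.
Qed.

Lemma ev_rmorph (F K : fieldType) (iota : {rmorphism F -> K}) (x : nat -> F)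
    (y : nat -> K) n (p : ipoly n) :
  (forall i, (i < n)%N -> y i = iota (x i)) -> ev y n p = iota (ev x n p).
Proof.
elim: n p => [|n IHn] p yx; first by rewrite /= rmorph_int.
rewrite !evS yx // -horner_map -map_poly_comp; congr _.[_].
by apply: eq_map_poly => c; apply: IHn => i lt_i_n; rewrite yx // ltnW.
Qed.

Lemma l1norm0 n : l1norm (0 : ipoly n) = 0%N.
Proof. by case: n => //= n; rewrite size_poly0 big_ord0. Qed.

Lemma l1norm_widen n (p : {poly ipoly n}) k : (size p <= k)%N ->
  @l1norm n.+1 p = (\sum_(i < k) l1norm p`_i)%N.
Proof.
move=> le_p_k; rewrite /= (big_ord_widen _ (fun i => l1norm p`_i) le_p_k).
rewrite [in RHS](bigID (fun i : 'I_k => (i < size p)%N)) /=.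
rewrite [X in (_ + X)%N]big1 ?addn0 // => i; rewrite -leqNgt => le_p_i.
by rewrite nth_default // l1norm0.
Qed.

Lemma l1norm1 n : l1norm (1 : ipoly n) = 1%N.
Proof. by elim: n => //= n IHn; rewrite size_poly1 big_ord1 coef1. Qed.

Lemma l1normN n (p : ipoly n) : l1norm (- p) = l1norm p.
Proof.
elim: n p => [|n IHn] p; first exact: abszN.
rewrite (@l1norm_widen _ _ (size (p : {poly ipoly n}))) ?size_polyN //=.
by apply: eq_bigr => i _; rewrite coefN.
Qed.

Lemma l1normD n (p q : ipoly n) : (l1norm (p + q) <= l1norm p + l1norm q)%N.
Proof.
elim: n p q => [|n IHn] p q.
  have abszD (a b : int) : (`|(a + b)%R| <= `|a| + `|b|)%N by lia.
  exact: abszD.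
set k := maxn (size (p : {poly _})) (size (q : {poly _})).
rewrite !(@l1norm_widen _ _ k) ?leq_maxl ?leq_maxr ?size_polyD //.
by rewrite -big_split leq_sum // => i _; rewrite coefD IHn.
Qed.

Lemma l1norm_sum n I (r : seq I) P (p : I -> ipoly n) :
  (l1norm (\sum_(i <- r | P i) p i)
   <= \sum_(i <- r | P i) l1norm (p i))%N.
Proof.
elim/big_ind2: _ => [|p1 k1 p2 k2 le1 le2|//]; first by rewrite l1norm0.
exact: leq_trans (l1normD _ _) (leq_add _ _).
Qed.

Lemma l1norm_monom n (c : ipoly n) k :
  l1norm (c *: 'X^k : ipoly n.+1) = l1norm c.
Proof.
have szc : (size (c *: 'X^k) <= k.+1)%N.
  by rewrite (leq_trans (size_scale_leq _ _)) ?size_polyXn.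
rewrite (l1norm_widen szc) (bigD1 ord_max) //= big1 => [|i neq_ik].
  by rewrite addn0 coefZ coefXn eqxx mulr1.
by rewrite coefZ coefXn (negPf (neq_ik : i != k :> nat)) mulr0 l1norm0.
Qed.

Lemma l1normM n (p q : ipoly n) : (l1norm (p * q) <= l1norm p * l1norm q)%N.
Proof.
elim: n p q => [|n IHn] p q; first by rewrite /= abszM.
pose sp := size (p : {poly ipoly n}); pose sq := size (q : {poly ipoly n}).
have -> : p * q = \sum_(i < sp) \sum_(j < sq)
    (((p : {poly _})`_i * (q : {poly _})`_j) *: 'X^(i + j) : {poly ipoly n}).
  rewrite -[LHS]/((p : {poly _}) * (q : {poly _})).
  rewrite -[in LHS](coefK (p : {poly _})) -[in LHS](coefK (q : {poly _})).
  rewrite !poly_def mulr_suml; apply: eq_bigr => i _.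
  rewrite mulr_sumr; apply: eq_bigr => j _.
  by rewrite -scalerAl -scalerAr scalerA exprD.
apply: leq_trans (l1norm_sum _ _ _) _; rewrite big_distrl leq_sum // => i _.
apply: leq_trans (l1norm_sum _ _ _) _; rewrite big_distrr leq_sum // => j _.
by rewrite l1norm_monom IHn.
Qed.

Lemma l1norm_prod n I (r : seq I) P (p : I -> ipoly n) :
  (l1norm (\prod_(i <- r | P i) p i)
   <= \prod_(i <- r | P i) l1norm (p i))%N.
Proof.
elim/big_ind2: _ => [|p1 k1 p2 k2 le1 le2|//]; first by rewrite l1norm1.
exact: leq_trans (l1normM _ _) (leq_mul _ _).
Qed.

Lemma degleW n d e (p : ipoly n) : (d <= e)%N -> degle d p -> degle e p.
Proof.
elim: n p => //= n IHn p le_de [szp dp]; split=> [|i]; last exact: IHn.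
exact: leq_trans szp _.
Qed.

Lemma degle0 n d : degle d (0 : ipoly n).
Proof. by elim: n => //= n IHn; rewrite size_poly0; split=> // i;
  rewrite coef0. Qed.

Lemma degle1 n d : degle d (1 : ipoly n).
Proof.
elim: n => //= n IHn; rewrite size_poly1; split=> // i.
by rewrite coef1; case: eqP => // _; apply: degle0.
Qed.

Lemma degleD n d (p q : ipoly n) : degle d p -> degle d q -> degle d (p + q).
Proof.
elim: n p q => //= n IHn p q [szp dp] [szq dq]; split=> [|i].
  by rewrite (leq_trans (size_polyD _ _)) // geq_max szp.
by rewrite coefD; apply: IHn.
Qed.

Lemma degleN n d (p : ipoly n) : degle d p -> degle d (- p).
Proof.
elim: n p => //= n IHn p [szp dp]; split=> [|i]; first by rewrite size_polyN.
by rewrite coefN; apply: IHn.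
Qed.

Lemma degle_sum n d I (r : seq I) (P : pred I) (p : I -> ipoly n) :
  (forall i, P i -> degle d (p i)) -> degle d (\sum_(i <- r | P i) p i).
Proof. by move=> dp; elim/big_ind: _ => //;
  [apply: degle0 | apply: degleD]. Qed.

Lemma degleM n d e (p q : ipoly n) :
  degle d p -> degle e q -> degle (d + e) (p * q).
Proof.
elim: n p q => //= n IHn p q [szp dp] [szq dq]; split=> [|i].
  rewrite (leq_trans (size_polyMleq _ _)) //.
  by rewrite -subn1 leq_subLR add1n -addnS -addSn leq_add.
by rewrite coefM; apply: degle_sum => j _; apply: IHn.
Qed.

Lemma degle_prod n I (r : seq I) (P : pred I) (d : I -> nat) (p : I -> ipoly n)
  :
  (forall i, P i -> degle (d i) (p i)) ->
  degle (\sum_(i <- r | P i) d i)%N (\prod_(i <- r | P i) p i).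
Proof.
move=> dp; elim/big_rec2: _ => [|i e q Pi]; first exact: degle1.
exact/degleM/dp.
Qed.

Lemma l1norm_var n i : (l1norm (var n i) <= 1)%N.
Proof.
elim: n => //= n IHn; case: eqP => _.
  by have := l1norm_monom (1 : ipoly n) 1;
    rewrite scale1r expr1 l1norm1 /= => ->.
by have := l1norm_monom (var n i) 0; rewrite alg_polyC /= => ->.
Qed.

Lemma degle_var n i : degle 1 (var n i).
Proof.
elim: n => //= n IHn; case: eqP => _.
  rewrite size_polyX; split=> // j; rewrite coefX.
  by case: eqP => _; [apply: degle1 | apply: degle0].
rewrite (leq_trans (size_polyC_leq1 _)) //; split=> // j; rewrite coefC.
by case: eqP => _ //; apply: degle0.
Qed.

Lemma l1norm_det n k (A : 'M[ipoly n]_k) (b : 'I_k -> nat) :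
  (forall i j, l1norm (A i j) <= b i)%N ->
  (l1norm (\det A) <= k`! * \prod_i b i)%N.
Proof.
move=> bA; apply: leq_trans (l1norm_sum _ _ _) _.
rewrite -card_Sn -sum_nat_const leq_sum // => s _.
have -> : l1norm ((-1) ^+ s * \prod_i A i (s i)) = l1norm (\prod_i A i (s i)).
  by case: (odd_perm s); rewrite ?expr1 ?mulN1r ?l1normN // expr0 mul1r.
by apply: leq_trans (l1norm_prod _ _ _) _; apply: leq_prod.
Qed.

Lemma degle_det n k (A : 'M[ipoly n]_k) (d : 'I_k -> nat) :
  (forall i j, degle (d i) (A i j)) -> degle (\sum_i d i) (\det A).
Proof.
move=> dA; apply: degle_sum => s _; case: (odd_perm s).
  by rewrite expr1 mulN1r; apply/degleN/degle_prod.
by rewrite expr0 mul1r; apply: degle_prod.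
Qed.

(** * Rank and nonvanishing minors *)

(** Independence of the rows is certified by one polynomial inequation and
dependence by polynomial equations, which is what makes both notions
transferable from one field to another. *)
Lemma row_free_minor (F : fieldType) m s (A : 'M[F]_(m, s)) :
  row_free A <-> exists c : 'I_m -> 'I_s, \det (colsub c A) != 0.
Proof.
split=> [freeA | [c]]; last first.
  rewrite -unitfE -unitmxE -row_free_unit.
  have -> : colsub c A = A *m colsub c 1%:M by rewrite mulmx_colsub mulmx1.
  move=> freeAc; rewrite -row_leq_rank.
  by apply: leq_trans (mxrankM_maxl A (colsub c 1%:M)); rewrite row_leq_rank.
have fullAt : row_full A^T by rewrite /row_full mxrank_tr.
exists (fullrankfun fullAt); have := fullrowsub_unit fullAt.
by rewrite -unitmx_tr trmx_mxsub trmxK unitmxE unitfE.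
Qed.

Lemma row_free_col_mx (F : fieldType) m s (A : 'M[F]_(m, s)) (b : 'rV_s) :
  row_free (col_mx A b) = row_free A && ~~ (b <= A)%MS.
Proof.
have le_Ab : (A <= col_mx A b)%MS by rewrite -addsmxE addsmxSl.
have rank_le : (\rank (col_mx A b) <= \rank A + 1)%N.
  rewrite -addsmxE (leq_trans (mxrank_adds_leqif _ _)) // leq_add2l.
  exact: rank_leq_row.
have [leb|nleb] /= := boolP (b <= A)%MS.
  rewrite andbF; apply: negbTE;
    rewrite -row_leq_rank -ltnNge [ltnRHS]addn1 ltnS.
  by rewrite (leq_trans _ (rank_leq_row A)) // mxrankS // col_mx_sub submx_refl.
have rankE : \rank (col_mx A b) = (\rank A + 1)%N.
  apply/eqP; rewrite eqn_leq rank_le addn1 ltn_neqAle mxrankS // andbT.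
  by rewrite (mxrank_leqif_sup le_Ab) col_mx_sub submx_refl.
by rewrite andbT /row_free rankE eqn_add2r.
Qed.

(** * Common factors of univariate polynomials *)

Section Univariate.
Variable K : fieldType.
Implicit Types (f g h p q : {poly K}).

Lemma irreducible_factor h : (1 < size h)%N ->
  exists2 p, irreducible_poly p & p %| h.
Proof.
have [n] := ubnP (size h); elim: n h => // n IHn h ltn szh.
have [irr_h | red_h] := EM (irreducible_poly h); first by exists h.
have [q [szq qh neq_qh]] : exists q, [/\ size q != 1, q %| h & ~~ (q %= h)].
  apply: contrapT => noq; apply: red_h; split=> // q szq qh.
  by apply: contrapT => /negP neq; apply: noq; exists q.
have h0 : h != 0 by rewrite -size_poly_gt0 ltnW.
have q0 : q != 0 by apply: contraNneq h0 => q0; rewrite -dvd0p -q0.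
have lt_q : (size q < size h)%N.
  by rewrite ltn_neqAle dvdp_leq // andbT dvdp_size_eqp.
have [||p irr_p pq] := IHn q; first exact: leq_trans lt_q _.
  by rewrite ltn_neqAle eq_sym szq size_poly_gt0.
by exists p => //; apply: dvdp_trans qh.
Qed.

Lemma dvdp_exp_of_irreducible h g : h != 0 ->
  (forall p, irreducible_poly p -> p %| h -> p %| g) -> h %| g ^+ (size h).-1.
Proof.
have [n] := ubnP (size h); elim: n h => // n IHn h ltn h0 hg.
have [szh|szh] := leqP (size h) 1.
  by rewrite (eqp_dvdl _ (_ : h %= 1)) ?dvd1p // -size_poly_eq1 eqn_leq szh
    size_poly_gt0.
have [p irr_p /dvdpP[q hE]] := irreducible_factor szh.
have p0 := irredp_neq0 irr_p.
have q0 : q != 0 by apply: contraNneq h0 => q0; rewrite hE q0 mul0r.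
have szE : size h = (size q + (size p).-1)%N.
  by rewrite hE size_mul // -subn1 -addnBA ?size_poly_gt0 // subn1.
have lt_q : (size q < size h)%N.
  by rewrite szE -[ltnLHS]addn0 ltn_add2l; have [] := irr_p;
    case: (size p) => [|[]].
have qg : q %| g ^+ (size q).-1.
  apply: IHn => // [|r irr_r rq]; first exact: leq_trans lt_q _.
  by apply: hg => //; rewrite hE dvdp_mulr.
rewrite {1}hE.
have -> : (size h).-1 = ((size q).-1 + (size p).-1)%N.
  by rewrite szE -!subn1 addnBAC ?size_poly_gt0.
rewrite exprD dvdp_mul //; have [lt1p _] := irr_p.
have -> : (size p).-1 = (size p).-2.+1 by case: (size p) lt1p => [|[]].
by rewrite exprS dvdp_mulr // hg // hE dvdp_mull.
Qed.

(** Bezout for a finite family, with the gcd left implicit as the combination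
that divides every member. *)
Lemma gcd_comb m (f : 'I_m -> {poly K}) :
  exists a : 'I_m -> {poly K}, forall i, \sum_j a j * f j %| f i.
Proof.
elim: m f => [|m IHm] f; first by exists (fun=> 0) => -[].
have [a ha] := IHm (fun i => f (lift ord0 i)).
set h := \sum_j _ in ha.
have [u uE] := Bezoutp (f ord0) h.
exists (fun i => oapp (fun j => u.2 * a j) u.1 (unlift ord0 i)) => i.
have -> : \sum_j oapp (fun j => u.2 * a j) u.1 (unlift ord0 j) * f j
   = u.1 * f ord0 + u.2 * h.
  rewrite big_ord_recl unlift_none /= /h mulr_sumr; congr (_ + _).
  by apply: eq_bigr => j _; rewrite liftK /= mulrA.
rewrite (eqp_dvdl _ uE); case: (unliftP ord0 i) => [j|] ->.
  exact: dvdp_trans (dvdp_gcdr _ _) (ha j).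
exact: dvdp_gcdl.
Qed.

(** Reducing all coefficients but one modulo a fixed nonzero member [f i0] makes
them of degree less than [d]; the degree of the last coefficient is then forced
by that of [b]. *)
Lemma bounded_comb m d (f a : 'I_m -> {poly K}) (b : {poly K}) i0 :
  (0 < d)%N ->
  (forall i, (size (f i) <= d.+1)%N) -> (size b <= (d * d).+1)%N ->
  f i0 != 0 -> b = \sum_i a i * f i ->
  exists2 a' : 'I_m -> {poly K},
    forall i, (size (a' i) <= (d * d).+1)%N & b = \sum_i a' i * f i.
Proof.
move=> d_gt0 szf szb fi0 bE.
pose a' i := if i == i0 then a i0 + \sum_(j | j != i0) (a j %/ f i0) * f j
  else a i %% f i0.
have bE' : b = \sum_i a' i * f i.
  rewrite bE (bigD1 i0) //= [RHS](bigD1 i0) //= /a' eqxx mulrDl -addrA.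
  congr (_ + _); rewrite mulr_suml -big_split /=.
  apply: eq_bigr => i /negPf ->.
  by rewrite [X in X * f i](divp_eq _ (f i0)) mulrDl mulrAC.
exists a' => // i; have [->{i}|neq_i] := eqVneq i i0; last first.
  rewrite /a' (negPf neq_i) ltnW // ltnS.
  rewrite (leq_trans (_ : _ <= d)%N) ?leq_pmulr //.
  by rewrite -ltnS (leq_trans _ (szf i0)) // ltn_modp.
have [->|a'0] := eqVneq (a' i0) 0; first by rewrite size_poly0.
apply: (@leq_trans (size (a' i0 * f i0))).
  by rewrite size_mul // -subn1 -addnBA ?size_poly_gt0 // leq_addr.
have -> : a' i0 * f i0 = b - \sum_(i | i != i0) a' i * f i.
  by apply/eqP; rewrite eq_sym subr_eq bE' [X in X == _](bigD1 i0).
rewrite (leq_trans (size_polyD _ _)) // geq_max szb size_polyN /=.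
rewrite (leq_trans (size_sum _ _ _)) //; apply/bigmax_leqP => i neq_i.
rewrite (leq_trans (size_polyMleq _ _)) // /a' (negPf neq_i).
have le_mod : (size (a i %% f i0)%R <= d)%N.
  by rewrite -ltnS (leq_trans _ (szf i0)) // ltn_modp.
rewrite -subn1 leq_subLR (leq_trans (leq_add le_mod (szf i))) //.
nia.
Qed.

(** A Nullstellensatz in one variable with explicit degrees, valid over a field
that need not be algebraically closed: if [g ^ d] has no bounded expression in
terms of the [f i], then some irreducible polynomial, a root to be adjoined,
divides all of them but not [g]. *)
Lemma common_irreducible m d (f : 'I_m -> {poly K}) g i0 :
  (0 < d)%N -> (forall i, (size (f i) <= d.+1)%N) -> (size g <= d.+1)%N ->
  f i0 != 0 ->
  (forall a : 'I_m -> {poly K}, (forall i, (size (a i) <= (d * d).+1)%N) ->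
     g ^+ d <> \sum_i a i * f i) ->
  exists p, [/\ irreducible_poly p, (size p <= d.+1)%N,
    forall i, p %| f i & ~~ (p %| g)].
Proof.
move=> d_gt0 szf szg fi0 g_notin; apply: contrapT => nop.
(* If no such factor existed, all irreducible factors of the gcd h would divide
   g, and h, of degree at most d, would divide g ^ d. *)
have [a hf] := gcd_comb f; set h := \sum_j _ in hf.
have h0 : h != 0 by apply: contraNneq fi0 => h0; rewrite -dvd0p -h0.
have szh : (size h <= d.+1)%N by rewrite (leq_trans _ (szf i0)) // dvdp_leq.
have : h %| g ^+ d.
  apply: dvdp_trans (_ : g ^+ (size h).-1 %| _); last first.
    by rewrite dvdp_exp2l // -subn1 leq_subLR.
  apply: dvdp_exp_of_irreducible => // p irr_p ph.
  apply: contrapT => /negP npg; apply: nop; exists p; split=> // [|i].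
    by rewrite (leq_trans _ szh) // dvdp_leq.
  exact: dvdp_trans (hf i).
case/dvdpP=> q gE.
have [||a' sza'] := @bounded_comb m d f (fun i =>
  q * a i) (g ^+ d) i0 d_gt0 szf _ fi0.
- rewrite (leq_trans (size_poly_exp_leq _ _)) // ltnS leq_mul2r.
  by rewrite -subn1 leq_subLR szg orbT.
- by rewrite gE mulr_sumr; apply: eq_bigr => i _; rewrite mulrA.
by apply: g_notin.
Qed.

End Univariate.

Lemma adjoin_root (K : finFieldType) (p : {poly K}) : irreducible_poly p ->
  exists (L : finFieldType) (iota : {rmorphism K -> L}) (z : L),
    #|L| = (#|K| ^ (size p).-1)%N /\
    forall q, root (map_poly iota q) z = (p %| q).
Proof.
move=> irr_p; have p0 := irredp_neq0 irr_p.
(* The quotient construction of finite fields asks for a monic modulus. *)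
pose h := (lead_coef p)^-1 *: p.
have hp : h %= p by rewrite eqp_scale // invr_eq0 lead_coef_eq0.
have monh : h \is monic by rewrite monicE lead_coefZ mulVf // lead_coef_eq0.
have irr_h : irreducible_poly h.
  case: irr_p => szp irr; split; first by rewrite (eqp_size hp).
  move=> q szq qh; rewrite (eqp_trans (irr q szq _)) 1?eqp_sym //.
  by rewrite -(eqp_dvdr _ hp).
pose hI : monic_irreducible_poly h := (irr_h, monh).
pose iota := qfpoly_const hI.
have iotaP : zmod_morphism iota /\ monoid_morphism iota.
  by split; [apply: qpolyC_is_zmod_morphism | apply: qpolyC_is_monoid_morphism].
pose iotaA := GRing.isZmodMorphism.Build _ _ iota iotaP.1.
pose iotaM := GRing.isMonoidMorphism.Build _ _ iota iotaP.2.
pose iotaR : {rmorphism K -> {poly %/ h with hI}} := HB.pack iota iotaA iotaM.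
exists {poly %/ h with hI}, iotaR, (in_qpoly h 'X); split=> [|q].
  by rewrite card_qfpoly (eqp_size hp).
rewrite -(eqp_dvdl _ hp) /root.
have := in_qpoly_comp_horner h q 'X; rewrite comp_polyXr => E.
rewrite -[_.[_]]/((map_poly (qpolyC h) q).[in_qpoly h 'X]) -E.
rewrite -val_eqE /= (mk_monicE hI).
by rewrite -Pdiv.IdomainMonic.modpE.
Qed.

(** * Elimination of one variable *)

(** One parameter serves for the degree and for the logarithm of the norm, so
that a single exponent describes the growth in an elimination step. *)
Definition bounded n d (p : ipoly n) := degle d p /\ (l1norm p <= 2 ^ d)%N.

Definition specializes n d (F K : fieldType) (x : nat -> F) (y : nat -> K) :=
  forall p : ipoly n, bounded d p -> ev x n p = 0 -> ev y n p = 0.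

Lemma l1norm_coef n (p : {poly ipoly n}) i :
  (l1norm p`_i <= @l1norm n.+1 p)%N.
Proof.
have [lt_i|le_i] := ltnP i (size p); last by rewrite nth_default // l1norm0.
by rewrite /= (bigD1 (Ordinal lt_i)) //= leq_addr.
Qed.

Lemma l1norm_exp n (p : ipoly n) k : (l1norm (p ^+ k) <= l1norm p ^ k)%N.
Proof.
elim: k => [|k IHk]; first by rewrite l1norm1.
by rewrite exprS expnS (leq_trans (l1normM _ _)) // leq_mul2l IHk orbT.
Qed.

Lemma degle_exp n d (p : ipoly n) k : degle d p -> degle (d * k) (p ^+ k).
Proof.
move=> dp; elim: k => [|k IHk]; first exact: degle1.
by rewrite exprS mulnS; apply: degleM.
Qed.

Lemma fact_leq_exp2 k : (k`! <= 2 ^ (k * k))%N.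
Proof.
elim: k => // k IHk; rewrite factS.
apply: leq_trans (leq_mul (ltnW (ltn_expl k.+1 (ltnSn 1))) IHk) _.
by rewrite -expnD leq_exp2l //; nia.
Qed.

(** The order [k] is at most [2 d ^ 2], so the degree of the determinant is at
most [2 d ^ 4], and the logarithm of its norm at most [k ^ 2 + 2 d ^ 4], that
is [6 d ^ 4]; the hypothesis [8 <= d] absorbs the constants. *)
Lemma minor_bounded n d k (A : 'M[ipoly n]_k) : (8 <= d)%N ->
  (k <= (d * d + d).+1)%N ->
  (forall i j, degle (d * d) (A i j)) ->
  (forall i j, (l1norm (A i j) <= 2 ^ (d * d))%N) ->
  bounded (d ^ 5) (\det A).
Proof.
move=> le8d lek dA lA.
have lek2 : (k <= 2 * (d * d))%N by nia.
have E5 : (d ^ 5 = d * d * (d * d) * d)%N by rewrite !expnS; nia.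
have le_d5 : (8 * (d * d * (d * d)) <= d ^ 5)%N by rewrite E5 mulnC leq_mul2l
  le8d orbT.
have lekd : (k * (d * d) <= 2 * (d * d * (d * d)))%N.
  by rewrite [leqRHS]mulnA leq_mul2r lek2 orbT.
have lekk : (k * k <= 4 * (d * d * (d * d)))%N.
  by apply: leq_trans (leq_mul lek2 lek2) _; lia.
split.
  have := degle_det (d := fun=> (d * d)%N) dA.
  by rewrite sum_nat_const card_ord; apply: degleW; lia.
have := l1norm_det (b := fun=> (2 ^ (d * d))%N) lA.
rewrite prod_nat_const card_ord -expnM => /leq_trans; apply.
apply: leq_trans (leq_mul (fact_leq_exp2 k) (leqnn _)) _.
rewrite -expnD leq_exp2l // [(d * d * k)%N]mulnC.
lia.
Qed.

Lemma exists_nonroot (K : finFieldType) (p : {poly K}) :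
  p != 0 -> (size p <= #|K|)%N -> exists z, ~~ root p z.
Proof.
move=> p0 szp; apply: contrapT => noz.
have rootp : all (root p) (enum K).
  by apply/allP => z _; apply: contrapT => /negP nz; apply: noz; exists z.
by have := max_poly_roots p0 rootp (enum_uniq _); rewrite -cardE ltnNge szp.
Qed.

Section Elimination.
Variables (F : fieldType) (x : nat -> F) (n d : nat).
Hypothesis le8d : (8 <= d)%N.

(* The number of coefficients of X ^ j f when j <= d ^ 2 and f has degree at
   most d; g ^ d fits as well. *)
Let s := (d * d + d).+1.

Let vanishing (f : ipoly n.+1) := bounded d f /\ ev x n.+1 f = 0.

Let shift (t : ipoly n.+1 * nat) : {poly ipoly n} := 'X^(t.2) * t.1.

Let admissible t := vanishing t.1 /\ (t.2 <= d * d)%N.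

Let rows m (t : 'I_m -> ipoly n.+1 * nat) : 'M[ipoly n]_(m, s) :=
  \matrix_i poly_rV (shift (t i)).

Let size_vanishing (f : {poly ipoly n}) : vanishing f -> (size f <= d.+1)%N.
Proof. by case=> -[[]]. Qed.

Let shift_bounded t i k : admissible t ->
  degle (d * d) ((poly_rV (shift t) : 'rV_s) i k) /\
  (l1norm ((poly_rV (shift t) : 'rV_s) i k) <= 2 ^ (d * d))%N.
Proof.
case=> -[[dt lt] _] _; rewrite mxE coefXnM.
have le_dd : (d <= d * d)%N by rewrite leq_pmulr // (leq_trans _ le8d).
case: ifP => _; first by rewrite l1norm0; split=> //; apply: degle0.
split; first by apply: (degleW le_dd); case: dt => _; apply.
by rewrite (leq_trans (l1norm_coef _ _)) // (leq_trans lt) // leq_exp2l.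
Qed.

(* A maximal independent family of rows is finite although there are many
   relations f: its length is at most the width s. *)
Let exists_maximal : exists m (t : 'I_m -> ipoly n.+1 * nat),
  [/\ forall i, admissible (t i), row_free (map_mx (ev x n) (rows t))
  & forall v, admissible v ->
     ~~ row_free (map_mx (ev x n) (col_mx (rows t) (poly_rV (shift v))))].
Proof.
pose P m := `[< exists t : 'I_m -> ipoly n.+1 * nat,
  (forall i, admissible (t i)) /\ row_free (map_mx (ev x n) (rows t)) >].
have exP : exists m, P m.
  exists 0%N; apply/asboolP; exists (fun=> (0, 0%N)); split=> [[]//|].
  by rewrite /row_free [map_mx _ _]flatmx0 mxrank0.
have boundP m : P m -> (m <= s)%N.
  by move=> /asboolP[t [_ /eqP <-]]; apply: rank_leq_col.
case: (ex_maxnP exP boundP) => m /asboolP[t [adm_t free_t]] max_m.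
exists m, t; split=> // v adm_v; apply/negP => free_tv.
suff /max_m : P (m + 1)%N by rewrite addn1 ltnn.
pose t' (i : 'I_(m + 1)) := match fintype.split i with inl j =>
  t j | inr _ => v end.
apply/asboolP; exists t'; split=> [i|].
  by rewrite /t'; case: (fintype.split i).
suff -> : rows t' = col_mx (rows t) (poly_rV (shift v)) by [].
apply/matrixP => i k; rewrite !mxE /t'.
by case: (fintype.split i) => j; rewrite !mxE.
Qed.

(** The polynomial [g'] is a nonzero minor of the rows of a maximal independent
family of shifted relations, completed by the row of [g ^ d].  At [y] it keeps
these rows independent, whereas the minors that vanish at [x] keep all other
shifted relations in the span of the family.  The condition [d < #|K|] matters
when all relations vanish identically at [y]: any element that is not a root
of [g] is then a valid coordinate. *)
Lemma elimination (g : ipoly n.+1) : bounded d g -> ev x n.+1 g != 0 ->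
  exists g' : ipoly n, [/\ bounded (d ^ 5) g', ev x n g' != 0 &
    forall (K : finFieldType) (y : nat -> K), (d < #|K|)%N ->
      specializes n (d ^ 5) x y -> ev y n g' != 0 ->
      exists (L : finFieldType) (iota : {rmorphism K -> L}) (y' : nat -> L),
        [/\ (#|L| <= #|K| ^ d)%N, specializes n.+1 d x y'
          & ev y' n.+1 g != 0]].
Proof.
move=> [dg lg] gx.
have [m [t [adm_t free_t max_t]]] := exists_maximal.
pose gd : {poly ipoly n} := (g : {poly ipoly n}) ^+ d.
have size_g : (size (g : {poly ipoly n}) <= d.+1)%N by case: dg.
have sizeX (R : nzRingType) (q : {poly R}) : (size q <= d.+1)%N ->
    (size (q ^+ d)%R <= s)%N.
  move=> szq; rewrite (leq_trans (size_poly_exp_leq _ _)) // ltnS.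
  by rewrite (leq_trans _ (leq_addr _ _)) // leq_mul2r -subn1 leq_subLR szq
    orbT.
have sizeS (R : nzRingType) (q : {poly R}) k : (size q <= d.+1)%N ->
    (k <= d * d)%N -> (size ('X^k * q)%R <= s)%N.
  move=> szq lek; rewrite (leq_trans (size_polyMleq _ _)) // size_polyXn /=.
  by rewrite /s -addnS leq_add.
have shift_map (K : fieldType) (y : nat -> K) v :
    map_poly (ev y n) (shift v) = 'X^(v.2) * map_poly (ev y n) v.1.
  by rewrite rmorphM /= map_polyXn.
have size_f (K : fieldType) (y : nat -> K) i :
    (size (map_poly (ev y n) (t i).1) <= d.+1)%N.
  by rewrite (leq_trans (size_poly _ _)) // size_vanishing //; case: (adm_t i).
have T_row (K : fieldType) (y : nat -> K) w (q : {poly K}) : (size q <= s)%N ->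
    poly_rV q = w *m map_mx (ev y n) (rows t) ->
    q = \sum_i (w 0 i *: 'X^((t i).2)) * map_poly (ev y n) (t i).1.
  move=> szq qE; rewrite -[LHS](poly_rV_K szq) qE mulmx_sum_row linear_sum.
  apply: eq_bigr => i _; rewrite linearZ /= -map_row rowK map_poly_rV.
  rewrite shift_map poly_rV_K ?scalerAl // sizeS ?size_f //.
  by case: (adm_t i).
have mapgd (K : fieldType) (y : nat -> K) :
    map_poly (ev y n) gd = map_poly (ev y n) (g : {poly ipoly n}) ^+ d.
  by rewrite rmorphXn.
have size_gd (K : fieldType) (y : nat -> K) : (size (map_poly (ev y n) gd) <=
  s)%N.
  by rewrite mapgd sizeX // (leq_trans (size_poly _ _)).
(* All shifted relations vanish at the last coordinate of x, but g ^ d does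
   not: hence its row is not in their span. *)
have free_tg : row_free (map_mx (ev x n) (col_mx (rows t) (poly_rV gd))).
  rewrite map_col_mx row_free_col_mx free_t /=; apply/negP => /submxP[w].
  rewrite map_poly_rV => /T_row gE.
  case/negP: gx; rewrite evS;
    have /eqP := congr1 (horner^~ (x n)) (gE (size_gd _ _)).
  rewrite /= mapgd horner_exp horner_sum big1.
    by rewrite expf_eq0 => /andP[].
  move=> i _; rewrite hornerM -[X in _ * X]/(ev x n.+1 (t i).1).
  by case: (adm_t i) => -[_ ->] _; rewrite mulr0.
have [c gx'] := (row_free_minor _).1 free_tg.
have detE (K : fieldType) (y : nat -> K) v c' :
  \det (colsub c' (map_mx (ev y n) (col_mx (rows t) v))) =
  ev y n (\det (colsub c' (col_mx (rows t) v))).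
  by rewrite -map_mxsub det_map_mx.
have le_ms : (m + 1 <= s)%N.
  by rewrite -(eqP free_tg) rank_leq_col.
have bounded_minor (v : 'rV[ipoly n]_s) c' :
  (forall i k, degle (d * d) (v i k : ipoly n) /\
      (l1norm (v i k : ipoly n) <= 2 ^ (d * d))%N) ->
  bounded (d ^ 5) (\det (colsub c' (col_mx (rows t) v))).
  move=> bv; apply: minor_bounded => // i k; rewrite !mxE;
  by case: (fintype.split i) => j; rewrite ?[rows t _ _]mxE;
   [case: (shift_bounded 0 (c' k) (adm_t j)) | case: (bv j (c' k))].
exists (\det (colsub c (col_mx (rows t) (poly_rV gd)))); split.
- apply: bounded_minor => i k; rewrite mxE; split.
    by have [_] := degle_exp d dg; apply.
  rewrite (leq_trans (l1norm_coef _ _)) // (leq_trans (l1norm_exp _ _)) //.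
  by rewrite expnM leq_exp2r // (leq_trans _ le8d).
- by rewrite -detE.
move=> K y lt_dK spec_y; rewrite -detE => gy'.
have : row_free (map_mx (ev y n) (col_mx (rows t) (poly_rV gd))).
  by apply/row_free_minor; exists c.
rewrite map_col_mx row_free_col_mx => /andP[free_ty gd_notin].
set T := map_mx (ev y n) (rows t) in free_ty gd_notin.
(* The enlarged family is dependent at x by maximality, so its minors vanish at
   x, hence at y. *)
have span_y v : admissible v -> (poly_rV (map_poly (ev y n) (shift v)) <= T)%MS.
  move=> adm_v; rewrite -map_poly_rV; apply: contrapT => /negP notin.
  have /row_free_minor[c' /negP[]] :
      row_free (map_mx (ev y n) (col_mx (rows t) (poly_rV (shift v)))).
    by rewrite map_col_mx row_free_col_mx free_ty.
  rewrite detE; apply/eqP/spec_y; first by apply: bounded_minor => i k;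
    apply: shift_bounded.
  rewrite -detE; apply/eqP; apply: contraNT (max_t v adm_v) => nz.
  by apply/row_free_minor; exists c'.
pose f i := map_poly (ev y n) (t i).1.
pose gy := map_poly (ev y n) (g : {poly ipoly n}).
have size_gy : (size gy <= d.+1)%N by rewrite (leq_trans (size_poly _ _)).
have in_ideal h : vanishing h -> exists w : 'I_m -> {poly K},
   map_poly (ev y n) h = \sum_i w i * f i.
  move=> vh; have /span_y/submxP[w] : admissible (h, 0%N) by [].
  rewrite /shift expr0 mul1r => /T_row -> ;
    first by exists (fun i => w 0 i *: 'X^((t i).2)).
  rewrite (leq_trans (size_poly _ _)) // (leq_trans (size_vanishing vh)) //
    ltnS.
  exact: leq_addl.
have [p [irr_p szp pf npg]] : exists p : {poly K}, [/\ irreducible_poly p,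
   (size p <= d.+1)%N, forall i, p %| f i & ~~ (p %| gy)].
  have [[i0 fi0]|f0] := EM (exists i, f i != 0).
    apply: (common_irreducible (i0 := i0) (d := d)) => // [|i|a sza].
    - by rewrite (leq_trans _ le8d).
    - exact: size_f.
    apply: contraNnot gd_notin => gyE.
    rewrite map_poly_rV mapgd gyE linear_sum summx_sub // => i _.
    rewrite -[a i]coefK poly_def mulr_suml linear_sum summx_sub // => j _.
    rewrite -scalerAl linearZ scalemx_sub //.
    have := span_y ((t i).1, val j); rewrite shift_map; apply; split=> /=.
      by case: (adm_t i).
    by rewrite -ltnS (leq_trans (ltn_ord j)).
  have [||z nz] := @exists_nonroot K gy.
  - apply: contraNneq gd_notin => gy0.
    by rewrite map_poly_rV mapgd -/gy gy0 expr0n gtn_eqF ?(leq_trans _ le8d) //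
      linear0 sub0mx.
  - by rewrite (leq_trans size_gy).
  exists ('X - z%:P); split=> [|||]; rewrite ?size_XsubC ?dvdp_XsubCl //.
  - exact: irredp_XsubC.
  - by rewrite ltnS (leq_trans _ le8d).
  move=> i; suff -> : f i = 0 by apply: dvdp0.
  by apply: contrapT => /eqP fi0; apply: f0; exists i.
have [L [iota [z [cardL rootz]]]] := adjoin_root irr_p.
pose y' i := if i == n then z else iota (y i).
have ev_y' h : ev y' n.+1 h = (map_poly iota (map_poly (ev y n) (h : {poly ipoly
  n}))).[z].
  rewrite evS {2}/y' eqxx -map_poly_comp; congr _.[_].
  apply: eq_map_poly => q /=; apply: ev_rmorph => i lt_i.
  by rewrite /y' ltn_eqF.
exists L, iota, y'; split.
- rewrite cardL leq_exp2l ?card_finNzRing_gt1 //.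
  by rewrite -subn1 leq_subLR.
- move=> h bh hx; apply/eqP; rewrite ev_y' -[_ == 0]/(root _ _) rootz.
  have [|w ->] := in_ideal h; first by [].
  elim/big_ind: _ => [|q r|i _]; [exact: dvdp0 | exact: dvdp_add |].
  by rewrite dvdp_mull.
- by rewrite ev_y' -[_ == 0]/(root _ _) rootz.
Qed.
End Elimination.

(** * Elimination of all variables *)

(** Each step replaces [d] by [d ^ 5] and contributes a factor [d] to the degree
of the extension, so the total degree is the product of the [d ^ (5 ^ i)],
[i < n], whose exponent [(5 ^ n - 1) / 4] is at most [5 ^ n - 1]. *)
Lemma specialization (F : fieldType) (x : nat -> F) n d (g : ipoly n) :
  [pchar F] =i pred0 -> (8 <= d)%N -> bounded d g -> ev x n g != 0 ->
  exists h : nat, [/\ (0 < h)%N, (h <= 2 ^ (d ^ (5 ^ n)))%N &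
    forall K : finFieldType, (d ^ (5 ^ n) < #|K|)%N -> h%:R != 0 :> K ->
      exists (L : finFieldType) (iota : {rmorphism K -> L}) (y : nat -> L),
        [/\ (#|L| <= #|K| ^ (d ^ (5 ^ n).-1))%N, specializes n d x y
          & ev y n g != 0]].
Proof.
move=> /pcharf0P F0.
(* Without variables, a relation is an integer that is zero in F. *)
have intr_eq0 (z : int) : z%:~R = 0 :> F -> z = 0.
  case: z => k /eqP; rewrite ?NegzE ?mulrNz ?oppr_eq0 -pmulrn F0 //.
  by move=> /eqP ->.
elim: n d g => [|n IHn] d g le8d bg gx.
  exists `|g : int|%N; split.
  - by rewrite absz_gt0; apply: contraNneq gx => ->.
  - by rewrite expn0 expn1; case: bg.
  move=> K _ gK; exists K, (idfun : {rmorphism K -> K}), (fun=> 0); split.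
  - by [].
  - by move=> p _ /intr_eq0 ->.
  - apply: contraNneq gK; rewrite /=; case: (g : int) => k.
      by rewrite -pmulrn => ->.
    by rewrite NegzE mulrNz -pmulrn => /eqP; rewrite oppr_eq0.
have [g' [bg' g'x step]] := elimination le8d bg gx.
have [|h [h0 leh hK]] := IHn (d ^ 5)%N g' _ bg' g'x.
  by rewrite (leq_trans le8d) // -{1}(expn1 d) leq_exp2l // (leq_trans _ le8d).
have dE : (d ^ 5 ^ n.+1 = (d ^ 5) ^ 5 ^ n)%N by rewrite -expnM -expnS.
have lt1d : (1 < d)%N by rewrite (leq_trans _ le8d).
exists h; split=> // [|K ltK hK0]; first by rewrite dE.
have [|K1 [iota1 [y1 [cardK1 spec1 g'y1]]]] := hK K _ hK0; first by rewrite -dE.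
have ltK1 : (d < #|K1|)%N.
  apply: leq_trans (leq_card _ (fmorph_inj iota1)).
  by apply: leq_trans ltK; rewrite ltnS -{1}(expn1 d) leq_exp2l // expn_gt0.
have [L [iota [y [cardL spec gy]]]] := step K1 y1 ltK1 spec1 g'y1.
exists L, (iota \o iota1 : {rmorphism K -> L}), y; split=> //.
apply: leq_trans cardL _;
  apply: (@leq_trans ((#|K| ^ ((d ^ 5) ^ (5 ^ n).-1)) ^ d)).
  by rewrite leq_exp2r // ltnW.
rewrite -expnM leq_exp2l ?card_finNzRing_gt1 // -expnM -expnSr leq_exp2l //.
have : (0 < 5 ^ n)%N by rewrite expn_gt0.
rewrite expnS; lia.
Qed.

(** * A small prime that does not divide a given integer *)

(** In Legendre's formula each power [p ^ k <= 2 m] contributes at most 1, and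
[p ^ k <= 2 ^ t] forces [k <= t]. *)
Lemma logn_bin_double_leq p m t : prime p -> (m.*2 <= 2 ^ t)%N ->
  (logn p 'C(m.*2, m) <= t)%N.
Proof.
move=> p_pr le_m.
have factE : ('C(m.*2, m) * (m`! * m`!))%N = (m.*2)`!.
  by have := @bin_fact m.*2 m; rewrite -addnn addnK; apply; rewrite leq_addr.
have /(congr1 (logn p)) := factE.
have bin_pos : (0 < 'C(m.*2, m))%N by rewrite bin_gt0 -addnn leq_addr.
rewrite !lognM ?muln_gt0 ?fact_gt0 // !logn_fact //.
have widen : (\sum_(1 <= k < m.+1) m %/ p ^ k =
    \sum_(1 <= k < m.*2.+1) m %/ p ^ k)%N.
  rewrite (@big_cat_nat _ _ _ m.+1 1 m.*2.+1) //=;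
    last by rewrite ltnS -addnn leq_addr.
  rewrite [X in _ = (_ + X)%N]big_nat [X in _ = (_ + X)%N]big1 ?addn0 // =>
    k /andP[lt_m _].
  by rewrite divn_small // (leq_trans lt_m) // ltnW // ltn_expl // prime_gt1.
rewrite widen => E.
have sum_le q : (\sum_(1 <= k < q.+1) (k <= t)%N <= t)%N.
  suff : (\sum_(1 <= k < q.+1) (k <= t)%N <= minn q t)%N by rewrite leq_min =>
    /andP[].
  elim: q => [|q IHq]; first by rewrite big_nil.
  by rewrite big_nat_recr //=; case: (leqP q.+1 t) => ?; lia.
suff : (\sum_(1 <= k < m.*2.+1) m.*2 %/ p ^ k <=
  \sum_(1 <= k < m.*2.+1) m %/ p ^ k + \sum_(1 <= k < m.*2.+1) m %/ p ^ k
  + \sum_(1 <= k < m.*2.+1) (k <= t)%N)%N.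
  rewrite -E => /leq_trans /(_ (leq_add (leqnn _) (sum_le _))).
  by rewrite addnC leq_add2l.
rewrite -!big_split /= !big_nat; apply: leq_sum => k /andP[k_gt0 _].
have [lt_tk|le_kt] := ltnP t k.
  rewrite divn_small // (leq_ltn_trans le_m) //.
  apply: (@leq_trans (2 ^ k)); first by rewrite ltn_exp2l.
  by rewrite leq_exp2r // prime_gt1.
have pk_gt0 : (0 < p ^ k)%N by rewrite expn_gt0 prime_gt0.
rewrite addn1 -ltnS ltn_divLR // -addnn.
have := ltn_ceil m pk_gt0; set q := (m %/ p ^ k)%N.
nia.
Qed.

Lemma exp2_leq_bin_double m : (2 ^ m <= 'C(m.*2, m))%N.
Proof.
elim: m => // m IHm; rewrite expnS doubleS binS.
apply: (@leq_trans ('C(m.*2, m) + 'C(m.*2, m)));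
  first by rewrite addnn mul2n leq_double.
by apply: leq_add; [rewrite binS leq_addl | case: (m) => // k;
  rewrite binS leq_addr].
Qed.

Lemma prime_dvdn_fact p n : prime p -> (p %| n`!)%N -> (p <= n)%N.
Proof.
move=> p_pr; elim: n => [|n IHn]; first by rewrite dvdn1 => /eqP p1;
  rewrite p1 in p_pr.
by rewrite factS Euclid_dvdM // => /orP[/dvdn_leq -> | /IHn/leqW].
Qed.

Lemma bin_dvdn_exp h t m : (0 < h)%N -> (m.*2 <= 2 ^ t)%N ->
  (forall p, prime p -> (p <= 2 ^ t)%N -> (p %| h)%N) -> ('C(m.*2,
    m) %| h ^ t)%N.
Proof.
move=> h_gt0 le_m hp; have binE : (0 < 'C(m.*2, m))%N.
  by rewrite bin_gt0 -addnn leq_addr.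
apply/dvdn_partP => // p; rewrite mem_primes => /and3P[p_pr _ p_bin].
rewrite p_part pfactor_dvdn ?expn_gt0 ?h_gt0 // lognX.
apply: leq_trans (logn_bin_double_leq p_pr le_m) _.
rewrite leq_pmulr // logn_gt0 mem_primes p_pr h_gt0 hp //.
apply: leq_trans le_m; apply: (prime_dvdn_fact p_pr).
apply: (dvdn_trans p_bin); rewrite -(@bin_fact m.*2 m) ?dvdn_mulr //.
by rewrite -addnn leq_addr.
Qed.

(** If all primes up to [2 ^ t.+1] divided [h], then [h ^ t.+1] would be a
multiple of the central binomial coefficient of order [2 ^ t], which is at least
[2 ^ (2 ^ t)]. *)
Lemma exists_prime_ndvdn h t u : (0 < h)%N -> (h <= 2 ^ u)%N ->
  (t.+1 * u < 2 ^ t)%N -> exists p, [/\ prime p,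
    (p <= 2 ^ t.+1)%N & ~~ (p %| h)%N].
Proof.
move=> h_gt0 le_hu lt_tu; apply: contrapT => nop.
have le_t : ((2 ^ t).*2 <= 2 ^ t.+1)%N by rewrite -mul2n -expnS.
have bin_h := bin_dvdn_exp h_gt0 le_t.
have /bin_h/dvdn_leq : forall p, prime p -> (p <= 2 ^ t.+1)%N -> (p %| h)%N.
  by move=> p p_pr le_p; apply: contrapT => /negP np; apply: nop; exists p.
rewrite expn_gt0 h_gt0 => /(_ isT).
rewrite leqNgt => /negP; apply.
apply: leq_trans (exp2_leq_bin_double (2 ^ t));
  apply: (@leq_ltn_trans (2 ^ (t.+1 * u))).
  by rewrite mulnC expnM leq_exp2r.
by rewrite ltn_exp2l.
Qed.

(** * Matroids as polynomial conditions *)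

Section Matroids.
Variable E : finType.
Implicit Types (M : matroid E) (I : {set E}).

Definition rows_of I (i : 'I_#|I|) : 'I_#|E| := enum_rank (enum_val i).

Lemma free_row_free (F : fieldType) r (W : 'M[F]_(#|E|, r)) I :
  free [seq (row (enum_rank e) W)^T | e in I] = row_free (rowsub (@rows_of I)
    W).
Proof.
set v := fun e => _; pose X := Tuple (introT eqP (size_image v (mem I))).
have nthX (i : 'I_#|I|) : X`_i = (row (rows_of i) W)^T by rewrite /= nth_image.
have sumX w : w *m rowsub (@rows_of I) W = (\sum_i w 0 i *: X`_i)^T.
  rewrite mulmx_sum_row linear_sum; apply: eq_bigr => i _.
  by rewrite row_rowsub nthX linearZ /= trmxK.
apply/(@freeP _ _ _ X)/idP => [freeX | freeW w w0 i].
  apply: inj_row_free => w; rewrite sumX => /eqP; rewrite trmx_eq0 => /eqP w0.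
  by apply/rowP => i; rewrite mxE (freeX (fun i => w 0 i)).
have : (\row_i w i) *m rowsub (@rows_of I) W == 0.
  rewrite sumX trmx_eq0 -[X in _ == X]w0; apply/eqP.
  by apply: eq_bigr => j _; rewrite mxE.
by rewrite mulmx_free_eq0 // => /eqP/rowP/(_ i); rewrite !mxE.
Qed.

Definition represents M (F : fieldType) k (W : 'M[F]_(#|E|, k)) :=
  forall I, (I \in indep M) = row_free (rowsub (@rows_of I) W).

Lemma representable_of_matrix M (F : fieldType) k (W : 'M[F]_(#|E|, k)) :
  represents M W -> representable M F.
Proof.
by move=> reprW; exists k, (fun e => (row (enum_rank e) W)^T) => I;
  rewrite free_row_free.
Qed.

Lemma represents_mulr M (F : fieldType) k r (W : 'M[F]_(#|E|,
  k)) (B : 'M[F]_(k, r)) :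
  row_free B -> represents M (W *m B) <-> represents M W.
Proof.
move=> freeB; split=> reprW I; rewrite reprW -?mul_rowsub_mx.
  by rewrite /row_free mxrankMfree.
by rewrite /row_free mxrankMfree.
Qed.

(** Writing the matrix as a product through its rank removes superfluous
coordinates, and a change of basis turns a full-rank set of rows into the
identity.  Keeping only the other entries variable is what makes the number of
variables at most [n ^ 2 / 4]. *)
Lemma normalized_matrix M (F : fieldType) : representable M F ->
  exists k (f : 'I_k -> 'I_#|E|) (W : 'M[F]_(#|E|, k)),
    [/\ injective f, rowsub f W = 1%:M & represents M W].
Proof.
move=> [r [v reprv]].
pose V : 'M[F]_(#|E|, r) := \matrix_i (v (enum_val i))^T.
have reprV : represents M V.
  move=> I; rewrite reprv -free_row_free; congr (free _).
  by apply: eq_map => e; rewrite rowK trmxK enum_rankK.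
have full := col_base_full V; pose W := col_base V.
have unitW := fullrowsub_unit full.
exists (\rank V), (fullrankfun full),
  (W *m invmx (rowsub (fullrankfun full) W)).
split; first exact: fullrankfun_inj.
  by rewrite -mul_rowsub_mx mulmxV.
apply/represents_mulr; first by rewrite row_free_unit unitmx_inv.
apply/(represents_mulr _ _ (row_base_free V)); by rewrite mulmx_base.
Qed.

End Matroids.

Lemma sqr_leq_exp2 n : (n * n <= 2 ^ n.*2)%N.
Proof. by rewrite -mul2n mulnC expnM leq_mul // ltnW // ltn_expl. Qed.

(** The inequation [g] is the product, over all independent sets, of a maximal
minor that does not vanish at [x]: at most [2 ^ n] factors of partial degrees
at most [n] and of norm at most [n!], whence the bound [2 ^ (3 n)].  The
dependent sets are taken care of by the relations of [x]. *)
Lemma matroid_conditions (E : finType) (M : matroid E) (F : fieldType) :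
  representable M F ->
  exists N (x : nat -> F) (g : ipoly N), let d := (2 ^ (3 * #|E|))%N in
   [/\ (4 * N <= #|E| ^ 2)%N, bounded d g, ev x N g != 0 &
   forall (K : fieldType) (y : nat -> K),
     specializes N d x y -> ev y N g != 0 ->
     representable M K].
Proof.
move=> /normalized_matrix[k [f [W [f_inj f1 reprW]]]].
set n := #|E| in f W f_inj f1 reprW *.
(* The positions outside the identity block, in the order that numbers the
   variables. *)
pose s := enum [pred ij : 'I_n * 'I_k | ij.1 \notin codom f]; pose N := size s.
pose A : 'M[ipoly N]_(n, k) := \matrix_(i, j)
  if (i, j) \in s then var N (index (i, j) s) else (i == f j)%:R.
pose x l := nth 0 [seq W ij.1 ij.2 | ij <- s] l.
have evA : map_mx (ev x N) A = W.
  apply/matrixP => i j; rewrite !mxE; case: ifPn => [ij_s|].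
    rewrite ev_var ?index_mem // /x (nth_map (i, j)) ?index_mem //.
    by rewrite nth_index.
  rewrite mem_enum inE negbK /= => /codomP[j0 ->].
  have /matrixP/(_ j0 j) := f1; rewrite !mxE => ->.
  by rewrite rmorph_nat (inj_eq f_inj).
pose minor (I : {set E}) (c : 'I_#|I| -> 'I_k) := \det (colsub c (rowsub
  (@rows_of E I) A)).
have minorE (K : fieldType) (y : nat -> K) (I : {set E}) c : ev y N (minor I c)
  =
    \det (colsub c (rowsub (@rows_of E I) (map_mx (ev y N) A))).
  by rewrite -!map_mxsub det_map_mx.
have degA i j : degle 1 (A i j).
  rewrite mxE; case: ifP => _; first exact: degle_var.
  by case: eqP => _; [apply: degle1 | apply: degle0].
have normA i j : (l1norm (A i j) <= 1)%N.
  rewrite mxE; case: ifP => _; first exact: l1norm_var.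
  by case: eqP => _; rewrite ?l1norm1 ?l1norm0.
have le_card (I : {set E}) : (#|I| <= n)%N by apply: max_card.
have deg_minor (I : {set E}) c : degle n (minor I c).
  have deg1 i j : degle 1 (colsub c (rowsub (@rows_of E I) A) i j).
    by rewrite 2!mxE; exact: degA.
  by have := degle_det (d := fun=> 1%N) deg1; rewrite sum1_card card_ord;
    exact: degleW.
have norm_minor (I : {set E}) c : (l1norm (minor I c) <= 2 ^ (n * n))%N.
  have norm1 i j : (l1norm (colsub c (rowsub (@rows_of E I) A) i j) <= 1)%N.
    by rewrite 2!mxE; exact: normA.
  have := l1norm_det (b := fun=> 1%N) norm1;
    rewrite big1_eq muln1 => /leq_trans; apply.
  by rewrite (leq_trans (fact_leq_exp2 _)) // leq_exp2l // leq_mul.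
have /choice[q qP] : forall I, exists p : ipoly N, I \in indep M ->
    exists2 c, p = minor I c & ev x N (minor I c) != 0.
  move=> I; have [indI|] := boolP (I \in indep M); last by exists 0.
  have := reprW I; rewrite indI => /esym/row_free_minor[c nz].
  by exists (minor I c) => _; exists c; rewrite // minorE evA.
have le_kn : (k <= n)%N by have := leq_card f f_inj; rewrite !card_ord.
have leMn : (#|indep M| <= 2 ^ n)%N.
  rewrite -[X in (_ <= _ ^ X)%N]cardsT -card_powerset powersetT cardsT.
  exact: max_card.
have le_n3 : (2 ^ n * n <= 2 ^ (3 * n))%N.
  rewrite mulSn expnD leq_mul2l expn_eq0 /= ltnW //.
  by rewrite (leq_trans (ltn_expl n (ltnSn 1))) // leq_exp2l // leq_pmull.
have le_n4 : (n * n * 2 ^ n <= 2 ^ (3 * n))%N.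
  by rewrite mulnC mulSn expnD leq_mul2l expn_eq0 /= mul2n sqr_leq_exp2.
exists N, x, (\prod_(I in indep M) q I); split.
- rewrite /N /s -cardE.
  have -> : #|[pred ij : 'I_n * 'I_k | ij.1 \notin codom f]| = ((n - k) * k)%N.
    rewrite (eq_card (B := predX [predC codom f] predT)); last first.
      by move=> [i j]; rewrite !inE andbT.
    rewrite cardX card_ord; congr (_ * _)%N; apply/eqP.
    by rewrite -(eqn_add2l k) -{1}(card_ord k) -(card_codom f_inj) cardC
      card_ord subnKC.
  by have := (nat_AGM2 (n - k) k).1; rewrite subnK.
- split.
    have degq I : I \in indep M -> degle n (q I) by case/qP=> c -> _;
      exact: deg_minor.
    have := degle_prod (index_enum _) degq; rewrite sum_nat_const;
      apply: degleW.
    by rewrite (leq_trans _ le_n3) // leq_mul2r leMn orbT.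
  rewrite (leq_trans (l1norm_prod _ _ _)) //.
  apply: (@leq_trans (\prod_(I in indep M) 2 ^ (n * n))).
    by apply: leq_prod => I /qP[c -> _]; exact: norm_minor.
  rewrite prod_nat_const -expnM leq_exp2l // (leq_trans _ le_n4) //.
  by rewrite leq_mul2l leMn orbT.
- rewrite rmorph_prod; apply/prodf_neq0 => I /qP[c -> //].
move=> K y spec_y; rewrite rmorph_prod => /prodf_neq0 gy.
apply: (@representable_of_matrix _ _ _ _ (map_mx (ev y N) A)) => I.
apply/idP/idP => [indI|].
  have [c qE _] := qP I indI; apply/row_free_minor; exists c.
  by rewrite -minorE -qE gy.
apply: contraTT; rewrite reprW => dep; apply/negP => /row_free_minor[c /negP[]].
rewrite -minorE; apply/eqP/spec_y.
  split.
    apply: degleW (deg_minor I c); rewrite (leq_trans _ le_n3) //.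
    by rewrite leq_pmull // expn_gt0.
  rewrite (leq_trans (norm_minor I c)) // leq_exp2l // (leq_trans _ le_n4) //.
  by rewrite leq_pmulr // expn_gt0.
apply/eqP; apply: contraNT dep => nz; apply/row_free_minor; exists c.
by rewrite -evA -minorE.
Qed.

(** * Bounds on the characteristic and on the order of the field *)

Lemma representable_card1 (E : finType) (M : matroid E) (F : fieldType) :
  #|E| = 1%N -> representable M F.
Proof.
move=> E1; have /cards1P[e setTE] : #|[set: E]| == 1%N by rewrite cardsT E1.
exists 1%N, (fun=> const_mx ([set: E] \in indep M)%:R) => I.
have : I \in powerset [set: E] by rewrite inE finset.subsetT.
rewrite {1}setTE powerset1 !inE => /orP[] /eqP ->.
  by rewrite indep0 /image_mem enum_set0 nil_free.
rewrite -setTE /image_mem setTE enum_set1 seq1_free -setTE.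
case: ([set: E] \in indep M); apply/esym/eqP; last by apply/matrixP=> i j;
  rewrite !mxE.
by move/matrixP/(_ 0 0)/eqP; rewrite !mxE oner_eq0.
Qed.

(** With [D = 2 ^ a], the prime must avoid the integer [h <= 2 ^ D] of the
elimination and also [D!], to make it larger than [D]; the product is at most
[2 ^ (D + D ^ 2)], and [D + D ^ 2 <= 2 ^ (2 a + 1)]. *)
Lemma representable_finite (E : finType) (M : matroid E) :
  representable0 M -> (0 < #|E|)%N ->
  exists N p (L : finFieldType), let a := (3 * #|E| * 5 ^ N)%N in
   [/\ (4 * N <= #|E| ^ 2)%N, p \in [pchar L], representable M L,
     (p <= 2 ^ (4 * a + 5))%N & (#|L| <= p ^ (2 ^ a))%N].
Proof.
move=> [F F0 reprF] E_gt0.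
have [N [x [g [leN bg gx reprK]]]] := matroid_conditions reprF.
set d := (2 ^ (3 * #|E|))%N in bg reprK.
have le8d : (8 <= d)%N by rewrite -[8%N]/(2 ^ 3)%N leq_exp2l // leq_pmulr.
have [h [h_gt0 leh hK]] := specialization F0 le8d bg gx.
set a := (3 * #|E| * 5 ^ N)%N.
have dE : (d ^ (5 ^ N) = 2 ^ a)%N by rewrite -expnM.
rewrite dE in leh hK.
have [|||p [p_pr lep]] :=
  @exists_prime_ndvdn (h * (2 ^ a)`!) (4 * a + 4) (2 ^ (2 * a + 1)).
- by rewrite muln_gt0 h_gt0 fact_gt0.
- apply: leq_trans (leq_mul leh (fact_leq_exp2 _)) _.
  rewrite -expnD leq_exp2l // addn1 expnS mul2n -addnn mul2n -addnn expnD
    leq_add2r.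
  by rewrite leq_pmull // expn_gt0.
- have -> : (4 * a + 4 = (2 * a + 3) + (2 * a + 1))%N by lia.
  rewrite [ltnRHS]expnD ltn_mul2r expn_gt0 /=.
  have -> : (2 * a + 3 + (2 * a + 1)).+1 = (2 * (2 * a + 2) + 1)%N by lia.
  have -> : (2 ^ (2 * a + 3) = 2 * 2 ^ (2 * a + 2))%N by rewrite -expnS -addnS.
  by have := ltn_expl (2 * a + 2) (ltnSn 1); lia.
rewrite Euclid_dvdM // negb_or => /andP[nph npd].
have ltap : (2 ^ a < p)%N.
  by rewrite ltnNge; apply: contraNN npd => le_p;
    rewrite dvdn_fact // prime_gt0.
have charp : p \in [pchar 'F_p] by apply: pchar_Fp.
have [||L [iota [y [cardL spec gy]]]] := hK 'F_p.
- by rewrite card_Fp.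
- by rewrite -(dvdn_pcharf charp).
rewrite card_Fp // in cardL.
exists N, p, L; split=> //.
- exact: rmorph_pchar charp.
- exact: reprK spec gy.
- by rewrite -addnS in lep.
apply: leq_trans cardL _;
  rewrite leq_exp2l ?prime_gt1 // -dE leq_exp2l ?leq_pred //.
by rewrite (leq_trans _ le8d).
Qed.

(** Comparison of [5 ^ N] with [8 ^ N] gives the result by exponents alone for
[n >= 3]; for [n = 2] the margin is small (245 against 256), and the values are
computed. *)
Lemma exponent_bound n N : (2 <= n)%N -> (4 * N <= n ^ 2)%N ->
  (5 * (3 * n * 5 ^ N) + 5 < 2 ^ (n ^ 3))%N.
Proof.
move=> n_ge2 leN.
have le58 : (5 ^ N <= 2 ^ (3 * N))%N by case: N {leN} => // N;
  rewrite expnM leq_exp2r.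
apply: (@leq_ltn_trans (15 * n * 2 ^ (3 * N) + 5)); first by nia.
have [n2|n_ge3] := leqP n 2.
  have n_eq2 : n = 2%N by lia.
  have N1 : (N <= 1)%N by move: leN; rewrite n_eq2 -[(2 ^ 2)%N]/4%N; lia.
  rewrite n_eq2.
  by case: N N1 {leN le58} => [|[]].
have lt_n : (n < 2 ^ n)%N by apply: ltn_expl.
have pos : (0 < 2 ^ (3 * N))%N by rewrite expn_gt0.
apply: (@leq_trans (2 ^ 5 * 2 ^ n * 2 ^ (3 * N))).
  by rewrite -[(2 ^ 5)%N]/32%N; nia.
by rewrite -!expnD leq_exp2l // expnS; rewrite expnS expn1 in leN *; nia.
Qed.

Lemma representable_small_field (E : finType) (M : matroid E) (n := #|E|) :
  representable0 M -> (0 < n)%N ->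
  exists p (L : finFieldType), [/\ p \in [pchar L], representable M L,
    (p < 2 ^ (2 ^ (n ^ 5)))%N & (#|L| < 2 ^ (2 ^ (2 ^ (n ^ 3))))%N].
Proof.
move=> M0; case: (ltngtP n 1) => // [n_gt1 _|n1 _]; last first.
  exists 2%N, 'F_2; split; first exact: pchar_Fp.
  - exact: representable_card1.
  - by rewrite n1 exp1n.
  - by rewrite n1 exp1n card_Fp.
have [|N [p [L [leN charp reprL lep leL]]]] := representable_finite M0;
  first exact: ltnW.
have := exponent_bound n_gt1 leN; rewrite -/n in leL lep *.
set a := (3 * n * 5 ^ N)%N in leL lep * => lt_a.
have le_n : (2 ^ (n ^ 3) <= 2 ^ (n ^ 5))%N.
  by rewrite leq_exp2l // leq_exp2l.
exists p, L; split=> //.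
  apply: leq_ltn_trans lep _; rewrite ltn_exp2l //; lia.
apply: leq_ltn_trans leL _.
apply: (@leq_ltn_trans ((2 ^ (4 * a + 5)) ^ 2 ^ a));
  first by rewrite leq_exp2r ?expn_gt0.
rewrite -expnM ltn_exp2l //.
apply: (@leq_ltn_trans (2 ^ (4 * a + 5) * 2 ^ a));
  first by rewrite leq_mul2r ltnW ?orbT // ltn_expl.
by rewrite -expnD ltn_exp2l //; lia.
Qed.

Lemma log2e_lt (R : realType) (x : \bar R) (k : nat) :
  (x < ((2 ^ k)%N%:R)%:E)%E -> (log2e x < (k%:R)%:E)%E.
Proof.
have ln2 : 0 < ln 2 :> R by rewrite ln_gt0 // ltr1n.
rewrite /log2e; case: x => [r| |] //=; last first.
  by move=> _; rewrite gt0_mulNye ?lte_fin ?invr_gt0 // ltNyr.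
rewrite lte_fin; case: ifPn => [r0 _|].
  by rewrite gt0_mulNye ?lte_fin ?invr_gt0 // ltNyr.
rewrite -ltNge => r_gt0 lt_r; rewrite -EFinM lte_fin ltr_pdivrMr //.
rewrite mulr_natl -lnXn // ltr_ln ?posrE ?exprn_gt0 //.
by rewrite -natrX.
Qed.

Theorem theorem3p1 (R : realType) (n : nat) (hn : (0 < n)%N) :
  (log2e (log2e (c0 R n)) < ((n ^ 5)%N%:R)%:E)%E /\
  (log2e (log2e (log2e (f0 R n))) < ((n ^ 3)%N%:R)%:E)%E.
Proof.
have sup_lt (S : forall E : finType, matroid E -> set nat) (b : nat) :
    (0 < b)%N ->
    (forall (E : finType) (M : matroid E), #|E| = n -> representable0 M ->
       exists2 k, S E M k & (k < b)%N) ->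
    (sup_repr0 (fun E M => least R (S E M)) n < (b%:R)%:E)%E.
  (* The strict bound for each matroid survives the supremum because the values
     are integers. *)
  case: b => // b _ Sb; apply: (@le_lt_trans _ _ (b%:R)%:E); last first.
    by rewrite lte_fin ltr_nat.
  apply: ge_ereal_sup => _ [E [M [En M0 ->]]].
  have [k Sk le_k] := Sb E M En M0.
  apply: (@le_trans _ _ (k%:R)%:E); last by rewrite lee_fin ler_nat.
  by apply: ereal_inf_lbound; exists k.
split.
  do 2!apply: log2e_lt; apply: (sup_lt repr_chars); first by rewrite expn_gt0.
  move=> E M En M0;
    have [|p [L [charp reprL ltp _]]] := representable_small_field M0.
    by rewrite En.
  by exists p; [exists L | rewrite -En].
do 3!apply: log2e_lt; apply: (sup_lt repr_orders); first by rewrite expn_gt0.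
move=> E M En M0; have [|p [L [_ reprL _ ltL]]] := representable_small_field M0.
  by rewrite En.
by exists #|L|; [exists L | rewrite -En].
Qed.
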